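(* Let $(A,M)$ be a self-dual Schur pair, $S=\mathrm{End}_A(M)$, and let $\lambda,\mu\in\mathscr P$. Then the simple right $S$-module $L^\mu$ appears in the socle of the projective indecomposable right $S$-module $P^\lambda$ only if $\mu\in\mathcal K$.
   Context: $K$ is a field; all algebras and modules are finite dimensional over $K$. A Schur pair is a pair $(A,M)$ where $A$ is a self-injective finite dimensional $K$-algebra and $M$ is a faithful finite dimensional right $A$-module; $S=S_A(M)=\mathrm{End}_A(M)$, acting on $M$ from the left. It is assumed that $A$ and $S$ are split over $K$. The Schur pair is self-dual if $A$ is equipped with an anti-involution $*$ such that $M\cong M^*$ as right $A$-modules, where $M^*=\mathrm{Hom}_K(M,K)$ with $(fa)(x)=f(xa^* )$. Let $\{L^\lambda:\lambda\in\mathscr P\}$ be a complete set of pairwise non-isomorphic simple right $S$-modules and $P^\lambda$ the projective cover of $L^\lambda$. Let $\mathsf F(X)=X\otimes_SM$ (a right $A$-module via $(x\otimes m)a=x\otimes ma$) for a right $S$-module $X$; put $D^\lambda=\mathsf F(L^\lambda)$ and $\mathcal K=\{\lambda\in\mathscr P:D^\lambda\ne0\}$. *)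

(* Defs.v *)
From HB Require Import structures.
From mathcomp Require Import all_boot all_order all_algebra all_field.

Set Implicit Arguments.
Unset Strict Implicit.
Unset Printing Implicit Defensive.

Import GRing.Theory.
Local Open Scope ring_scope.

Record rmodType (K : fieldType) (A : falgType K) := RMod {
  rmod_sort :> vectType K;
  ract : rmod_sort -> A -> rmod_sort;
  ract_linearl : forall a, linear (fun x => ract x a);
  ract_linearr : forall x, linear (ract x);
  ract1 : forall x, ract x 1 = x;
  ractM : forall x a b, ract x (a * b) = ract (ract x a) b }.

Arguments ract {K A r} x a.

Lemma linear_mem_vbasis (K : fieldType) (U V : vectType K) (f : U -> V)
    (W : {vspace V}) :
  linear f -> (forall i : 'I_(\dim {:U}), f (vbasis {:U})`_i \in W) ->
  forall u, f u \in W.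
Proof.
move=> f_lin fW u.
pose g : {linear U -> V} := HB.pack f (GRing.isLinear.Build K U V _ f f_lin).
rewrite -[f]/(g : U -> V) (coord_vbasis (memvf u)) linear_sum.
apply: memv_suml => i _.
by rewrite linearZ memvZ // fW.
Qed.

Section Modules.

Variables (K : fieldType) (A : falgType K).
Implicit Types X Y : rmodType A.

Definition ractr X (a : A) (x : X) : X := ract x a.

HB.instance Definition _ X (a : A) :=
  GRing.isSemilinear.Build K X X _ (@ractr X a)
    (GRing.semilinear_linear (@ract_linearl K A X a)).

HB.instance Definition _ X (x : X) :=
  GRing.isSemilinear.Build K A X _ (ract x)
    (GRing.semilinear_linear (@ract_linearr K A X x)).

Definition ract_lfun X (a : A) : 'End(X) := linfun (@ractr X a).

Lemma ract_lfunE X a (x : X) : ract_lfun X a x = ract x a.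
Proof. exact: lfunE. Qed.

Definition is_rhom X Y (f : 'Hom(X, Y)) : Prop :=
  forall x a, f (ract x a) = ract (f x) a.

Definition lfun_surjective (U V : vectType K) (f : 'Hom(U, V)) : Prop :=
  forall v, exists u, f u = v.

Definition rmod_iso X Y : Prop :=
  exists f : 'Hom(X, Y), is_rhom f /\ bijective f.

Definition rmod_nonzero X : Prop := exists x : X, x <> 0.

Record submod X := Submod {
  submod_vs :> {vspace X};
  submod_stable : forall x a, x \in submod_vs -> ract x a \in submod_vs }.

Section SubModule.
Variables (X : rmodType A) (W : submod X).
Let sub_act (x : subvs_of W) (a : A) : subvs_of W :=
  Subvs (submod_stable a (subvsP x)).
Fact sub_act_linearl a : linear (fun x => sub_act x a).
Proof. by move=> k x y; apply: val_inj; rewrite /= ract_linearl. Qed.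
Fact sub_act_linearr x : linear (sub_act x).
Proof. by move=> k a b; apply: val_inj; rewrite /= linearP. Qed.
Fact sub_act1 x : sub_act x 1 = x.
Proof. by apply: val_inj; rewrite /= ract1. Qed.
Fact sub_actM x a b : sub_act x (a * b) = sub_act (sub_act x a) b.
Proof. by apply: val_inj; rewrite /= ractM. Qed.
Definition submod_rmod : rmodType A :=
  RMod sub_act_linearl sub_act_linearr sub_act1 sub_actM.
End SubModule.

(* The quotient space X/W is realised on the complement W^C chosen by the     *)
(* library, with projection quot_pi; see quot_piK and quot_pi_eq0.            *)
Section QuotModule.
Variables (X : rmodType A) (W : submod X).
Definition quot_space : vectType K := subvs_of (W^C)%VS.
Definition quot_pi : 'Hom(X, quot_space) :=
  (linfun (vsproj (W^C)%VS) \o daddv_pi (W^C)%VS W)%VF.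

Fact quot_cap : (W^C :&: W)%VS = 0%VS.
Proof. by rewrite capvC capv_compl. Qed.

Lemma quot_piK (q : quot_space) : quot_pi (vsval q) = q.
Proof.
apply: val_inj; rewrite /quot_pi comp_lfunE lfunE /=.
rewrite daddv_pi_id ?subvsP //; last exact: quot_cap.
by rewrite vsprojK ?subvsP.
Qed.

Lemma quot_pi_eq0 x : (quot_pi x == 0) = (x \in submod_vs W).
Proof.
have E: vsval (quot_pi x) = daddv_pi (W^C)%VS W x.
  by rewrite /quot_pi comp_lfunE lfunE /= vsprojK // memv_pi.
have D: daddv_pi (W^C)%VS W x + daddv_pi W (W^C)%VS x = x.
  by apply: daddv_pi_add; rewrite ?quot_cap // addvC addv_complf memvf.
rewrite -(inj_eq val_inj) /= E; apply/eqP/idP => [z|xW].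
  by rewrite -D z add0r memv_pi.
have: x - daddv_pi W (W^C)%VS x \in (W^C :&: W)%VS.
  rewrite memv_cap; apply/andP; split; first by rewrite -{1}D addrK memv_pi.
  by rewrite rpredB ?memv_pi.
by rewrite -{1}D addrK quot_cap memv0 => /eqP.
Qed.

Lemma quot_piB_mem x : x - vsval (quot_pi x) \in submod_vs W.
Proof. by rewrite -quot_pi_eq0 linearB /= quot_piK subrr. Qed.

Lemma quot_pi_act_val x a :
  quot_pi (ract (vsval (quot_pi x)) a) = quot_pi (ract x a).
Proof.
apply/eqP; rewrite -subr_eq0 -!linearB /= quot_pi_eq0.
rewrite -[_ - _](linearB (@ractr X a)) /=.
by apply: submod_stable; rewrite -quot_pi_eq0 linearB /= quot_piK subrr.
Qed.

Let quot_act (q : quot_space) (a : A) : quot_space :=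
  quot_pi (ract (vsval q) a).
Fact quot_act_linearl a : linear (fun q => quot_act q a).
Proof. by move=> k p q; rewrite /quot_act linearP ract_linearl linearP. Qed.
Fact quot_act_linearr q : linear (quot_act q).
Proof. by move=> k a b; rewrite /quot_act !linearP. Qed.
Fact quot_act1 q : quot_act q 1 = q.
Proof. by rewrite /quot_act ract1 quot_piK. Qed.
Fact quot_actM q a b : quot_act q (a * b) = quot_act (quot_act q a) b.
Proof. by rewrite /quot_act quot_pi_act_val ractM. Qed.
Definition quot_rmod : rmodType A :=
  RMod quot_act_linearl quot_act_linearr quot_act1 quot_actM.

Lemma quot_pi_rhom : is_rhom (quot_pi : 'Hom(X, quot_rmod)).
Proof. by move=> x a; rewrite /= /quot_act quot_pi_act_val. Qed.
End QuotModule.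

Definition rmod_simple X : Prop :=
  rmod_nonzero X /\
  forall W : submod X, submod_vs W = 0%VS \/ submod_vs W = fullv.

(* Membership in the socle, i.e. in the sum of all simple submodules; finite  *)
(* families suffice since every element of the sum lies in a finite subsum.   *)
Definition in_socle X (x : X) : Prop :=
  exists n (W : 'I_n -> submod X),
    (forall i, rmod_simple (submod_rmod (W i))) /\ x \in (\sum_i W i)%VS.

Definition appears_in_socle (L X : rmodType A) : Prop :=
  exists W : submod X,
    (forall x, x \in submod_vs W -> in_socle x) /\
    rmod_iso (submod_rmod W) L.

Definition rmod_injective (I : rmodType A) : Prop :=
  forall X Y (i : 'Hom(X, Y)) (f : 'Hom(X, I)),
    is_rhom i -> injective i -> is_rhom f ->
    exists2 h : 'Hom(Y, I), is_rhom h & forall x, h (i x) = f x.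

Definition rmod_projective (P : rmodType A) : Prop :=
  forall X Y (p : 'Hom(X, Y)) (f : 'Hom(P, Y)),
    is_rhom p -> lfun_surjective p -> is_rhom f ->
    exists2 h : 'Hom(P, X), is_rhom h & forall x, p (h x) = f x.

Definition projective_cover (P L : rmodType A) (p : 'Hom(P, L)) : Prop :=
  [/\ rmod_projective P, is_rhom p, lfun_surjective p &
      forall W : submod P, (W + lker p)%VS = fullv -> submod_vs W = fullv].

Fact regular_linearl (a : A) : linear (fun x : A => x * a).
Proof. by move=> k x y; rewrite mulrDl scalerAl. Qed.
Fact regular_linearr (x : A) : linear (fun a : A => x * a).
Proof. by move=> k a b; rewrite mulrDr scalerAr. Qed.
Definition regular_rmod : rmodType A :=
  @RMod K A A (fun x a => x * a) regular_linearl regular_linearr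
    (@mulr1 A) (@mulrA A).

Definition rmod_faithful X : Prop :=
  forall a, (forall x : X, ract x a = 0) -> a = 0.

Definition complete_simples (I : Type) (L : I -> rmodType A) : Prop :=
  [/\ forall i, rmod_simple (L i),
      forall i j, rmod_iso (L i) (L j) -> i = j &
      forall X, rmod_simple X -> exists i, rmod_iso X (L i)].

Record antiInvolution := AntiInvolution {
  ai_fun :> A -> A;
  ai_linear : linear ai_fun;
  ai_antiM : forall a b, ai_fun (a * b) = ai_fun b * ai_fun a;
  ai_invol : involutive ai_fun }.

Section Dual.
Variables (star : antiInvolution) (M : rmodType A).
Local Notation dual := 'Hom(M, K^o).
Let dual_act (f : dual) (a : A) : dual := (f \o ract_lfun M (star a))%VF.
Let dual_actE f a x : dual_act f a x = f (ract x (star a)).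
Proof. by rewrite comp_lfunE ract_lfunE. Qed.
Fact dual_act_linearl a : linear (fun f => dual_act f a).
Proof. by move=> k f g; apply/lfunP=> x; rewrite !(dual_actE, lfun_simp). Qed.
Fact dual_act_linearr f : linear (dual_act f).
Proof.
move=> k a b; apply/lfunP=> x.
by rewrite !(add_lfunE, scale_lfunE) !dual_actE ai_linear !linearP.
Qed.
Fact dual_act1 f : dual_act f 1 = f.
Proof.
apply/lfunP=> x; rewrite dual_actE.
suff ->: star 1 = 1 by rewrite ract1.
by rewrite -[LHS]mulr1 -{2}(ai_invol star 1) -ai_antiM mulr1 ai_invol.
Qed.
Fact dual_actM f a b : dual_act f (a * b) = dual_act (dual_act f a) b.
Proof. by apply/lfunP=> x; rewrite !dual_actE ai_antiM ractM. Qed.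
Definition dual_rmod : rmodType A :=
  @RMod K A dual dual_act
    dual_act_linearl dual_act_linearr dual_act1 dual_actM.
End Dual.

End Modules.

(* Split over K, in the sense that End_A(L) = K for every simple L.           *)
Definition split_alg (K : fieldType) (A : falgType K) : Prop :=
  forall L : rmodType A, rmod_simple L ->
  forall f : 'End(L), is_rhom f -> exists k : K, f = k *: \1%VF.

Record schurPair (K : fieldType) := SchurPair {
  sp_alg : falgType K;
  sp_mod : rmodType sp_alg;
  sp_self_injective : rmod_injective (regular_rmod sp_alg);
  sp_faithful : rmod_faithful sp_mod }.

(* The algebra S = End_A(M) of a Schur pair. It is nonzero, as required by    *)
(* falgType, because 1 <> 0 in A and M is faithful.                           *)
Section Endomorphisms.

Variables (K : fieldType) (SP : schurPair K).
Local Notation A := (sp_alg SP).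
Local Notation M := (sp_mod SP).

Definition end_defect (a : A) (f : 'End(M)) : 'End(M) :=
  (f \o ract_lfun M a)%VF - (ract_lfun M a \o f)%VF.

Lemma end_defectE a f x : end_defect a f x = f (ract x a) - ract (f x) a.
Proof. by rewrite add_lfunE opp_lfunE !comp_lfunE !ract_lfunE. Qed.

Fact end_defect_linear a : linear (end_defect a).
Proof.
move=> k f g; rewrite /end_defect comp_lfunDl comp_lfunDr.
by rewrite -comp_lfunZl -comp_lfunZr scalerBr opprD addrACA.
Qed.

HB.instance Definition _ a :=
  GRing.isSemilinear.Build K 'End(M) 'End(M) _ (end_defect a)
    (GRing.semilinear_linear (end_defect_linear a)).

(* A basis of A suffices: see end_vsP.                                        *)
Definition end_vs : {vspace 'End(M)} :=
  (\bigcap_(i < \dim {:A}) lker (linfun (end_defect (vbasis {:A})`_i)))%VS.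

Lemma end_vsP f : reflect (is_rhom f) (f \in end_vs).
Proof.
rewrite memvE; apply: (iffP subv_bigcapP) => [fE x a|fE i _].
  rewrite (coord_vbasis (memvf a)) (linear_sum (ract x)) !linear_sum /=.
  apply: eq_bigr => i _; rewrite !linearZ /=; congr (_ *: _).
  have:= fE i isT; rewrite -memvE memv_ker lfunE /= => /eqP/lfunP/(_ x).
  by rewrite zero_lfunE end_defectE => /eqP; rewrite subr_eq0 => /eqP.
rewrite -memvE memv_ker lfunE /=; apply/eqP; apply/lfunP=> x.
by rewrite !end_defectE fE subrr zero_lfunE.
Qed.

Definition schur_sort : Type := subvs_of end_vs.
HB.instance Definition _ := Vector.on schur_sort.

Implicit Types f g h : schur_sort.

Lemma schur_rhom f : is_rhom (vsval f).
Proof. exact/end_vsP/subvsP. Qed.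

Fact schur1_subproof : \1%VF \in end_vs.
Proof. by apply/end_vsP=> x a; rewrite !id_lfunE. Qed.
Fact schurM_subproof f g : (vsval f \o vsval g)%VF \in end_vs.
Proof. by apply/end_vsP=> x a; rewrite !comp_lfunE !schur_rhom. Qed.

(* (f * g) m = f (g m), since endomorphisms act on M from the left.           *)
Definition schur1 : schur_sort := Subvs schur1_subproof.
Definition schurM f g : schur_sort := Subvs (schurM_subproof f g).

Fact schurMA : associative schurM.
Proof. by move=> f g h; apply: val_inj; rewrite /= comp_lfunA. Qed.
Fact schur1M : left_id schur1 schurM.
Proof. by move=> f; apply: val_inj; rewrite /= comp_lfun1l. Qed.
Fact schurM1 : right_id schur1 schurM.
Proof. by move=> f; apply: val_inj; rewrite /= comp_lfun1r. Qed.
Fact schurMDl : left_distributive schurM +%R.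
Proof. by move=> f g h; apply: val_inj; rewrite /= comp_lfunDl. Qed.
Fact schurMDr : right_distributive schurM +%R.
Proof. by move=> f g h; apply: val_inj; rewrite /= comp_lfunDr. Qed.

Fact schur1_neq0 : schur1 != 0.
Proof.
apply/eqP=> /(congr1 val) /= /lfunP E.
suff /eqP: (1 : A) = 0 by rewrite oner_eq0.
apply: (@sp_faithful K SP) => x; rewrite ract1.
by have:= E x; rewrite id_lfunE zero_lfunE.
Qed.

HB.instance Definition _ := GRing.Zmodule_isNzRing.Build schur_sort
  schurMA schur1M schurM1 schurMDl schurMDr schur1_neq0.

Fact schurZl k f g : k *: (f * g) = (k *: f) * g.
Proof. by apply: val_inj; rewrite /= comp_lfunZl. Qed.
Fact schurZr k f g : k *: (f * g) = f * (k *: g).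
Proof. by apply: val_inj; rewrite /= comp_lfunZr. Qed.

HB.instance Definition _ :=
  GRing.Lmodule_isLalgebra.Build K schur_sort schurZl.
HB.instance Definition _ :=
  GRing.Lalgebra_isAlgebra.Build K schur_sort schurZr.
HB.instance Definition _ := Algebra_isFalgebra.Build K schur_sort.

Definition schur_alg : falgType K := schur_sort.

Definition end_app (s : schur_alg) (m : M) : M := vsval (s : schur_sort) m.

Lemma end_appM s t m : end_app (s * t) m = end_app s (end_app t m).
Proof. exact: comp_lfunE. Qed.

Lemma end_app1 m : end_app 1 m = m.
Proof. exact: id_lfunE. Qed.

Lemma end_app_linearl m : linear (fun s => end_app s m).
Proof. by move=> k s t; rewrite /end_app linearP /= !lfun_simp. Qed.

Lemma end_app_linearr s : linear (end_app s).
Proof. by move=> k x y; rewrite /end_app linearP. Qed.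

Lemma end_app_act s m a : end_app s (ract m a) = ract (end_app s m) a.
Proof. exact: schur_rhom. Qed.

End Endomorphisms.

Section SchurFunctor.

Variables (K : fieldType) (SP : schurPair K).
Local Notation A := (sp_alg SP).
Local Notation M := (sp_mod SP).
Local Notation S := (schur_alg SP).
Variable X : rmodType S.

(* X (x)_K M is realised as Hom_K(X^*, M), with x (x) m the map sending phi   *)
(* to phi(x) m.                                                               *)
Definition tensK : vectType K := 'Hom('Hom(X, K^o), M).

Definition pureK_fun (x : X) (m : M) (phi : 'Hom(X, K^o)) : M :=
  (phi x : K) *: m.
Fact pureK_fun_linear x m : linear (pureK_fun x m).
Proof. by move=> k f g; rewrite /pureK_fun !lfun_simp scalerDl scalerA. Qed.
HB.instance Definition _ x m :=
  GRing.isSemilinear.Build K 'Hom(X, K^o) M _ (pureK_fun x m)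
    (GRing.semilinear_linear (pureK_fun_linear x m)).

Definition pureK (x : X) (m : M) : tensK := linfun (pureK_fun x m).

Lemma pureKE x m phi : pureK x m phi = (phi x : K) *: m.
Proof. by rewrite /pureK lfunE. Qed.

Lemma pureK_linearl m : linear (fun x => pureK x m).
Proof.
move=> k x y; apply/lfunP=> phi.
by rewrite add_lfunE scale_lfunE !pureKE linearP scalerDl scalerA.
Qed.

Lemma pureK_linearr x : linear (pureK x).
Proof.
move=> k m n; apply/lfunP=> phi.
by rewrite add_lfunE scale_lfunE !pureKE scalerDr !scalerA mulrC.
Qed.

Let tensK_act (t : tensK) (a : A) : tensK := (ract_lfun M a \o t)%VF.
Let tensK_actE t a phi : tensK_act t a phi = ract (t phi) a.
Proof. by rewrite comp_lfunE ract_lfunE. Qed.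
Fact tensK_act_linearl a : linear (fun t => tensK_act t a).
Proof.
move=> k t u; apply/lfunP=> phi.
by rewrite add_lfunE scale_lfunE !tensK_actE add_lfunE scale_lfunE
  [LHS](linearP (@ractr K A M a)).
Qed.
Fact tensK_act_linearr t : linear (tensK_act t).
Proof.
move=> k a b; apply/lfunP=> phi.
by rewrite add_lfunE scale_lfunE !tensK_actE linearP.
Qed.
Fact tensK_act1 t : tensK_act t 1 = t.
Proof. by apply/lfunP=> phi; rewrite tensK_actE ract1. Qed.
Fact tensK_actM t a b : tensK_act t (a * b) = tensK_act (tensK_act t a) b.
Proof. by apply/lfunP=> phi; rewrite !tensK_actE ractM. Qed.
Definition tensK_rmod : rmodType A :=
  RMod tensK_act_linearl tensK_act_linearr tensK_act1 tensK_actM.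

Lemma pureK_act x m a : ract (pureK x m : tensK_rmod) a = pureK x (ract m a).
Proof.
apply/lfunP=> phi; rewrite [LHS]tensK_actE !pureKE.
exact: (linearZZ (@ractr K A M a)).
Qed.

Definition balance (x : X) (s : S) (m : M) : tensK :=
  pureK (ract x s) m - pureK x (end_app s m).

(* The span of all xs (x) m - x (x) sm; see balance_mem.                      *)
Definition balance_vs : {vspace tensK} :=
  (\sum_(i < \dim {:X}) \sum_(j < \dim {:S}) \sum_(l < \dim {:M})
     <[balance (vbasis {:X})`_i (vbasis {:S})`_j (vbasis {:M})`_l]>)%VS.

Lemma balance_mem x s m : balance x s m \in balance_vs.
Proof.
apply: (@linear_mem_vbasis K X tensK (fun x => balance x s m)) => [k y z|i].
  rewrite /balance ract_linearl !pureK_linearl.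
  by rewrite scalerBr opprD addrACA.
apply: (@linear_mem_vbasis K S tensK (fun s => balance _ s m)) => [k y z|j].
  rewrite /balance ract_linearr pureK_linearl end_app_linearl pureK_linearr.
  by rewrite scalerBr opprD addrACA.
apply: (@linear_mem_vbasis K M tensK (balance _ _)) => [k y z|l].
  rewrite /balance end_app_linearr !pureK_linearr.
  by rewrite scalerBr opprD addrACA.
apply: (subvP (sumv_sup i isT _)) (memv_line _).
apply: (sumv_sup j isT); exact: (sumv_sup l isT (subvv _)).
Qed.

Lemma balance_act x s m a :
  ract (balance x s m : tensK_rmod) a = balance x s (ract m a).
Proof.
have actB (t u : tensK_rmod) : ract (t - u) a = ract t a - ract u a.
  exact: (linearB (@ractr K A tensK_rmod a)).
by rewrite [LHS]actB !pureK_act -end_app_act.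
Qed.

Lemma balance_vs_stable (t : tensK_rmod) a :
  t \in balance_vs -> ract t a \in balance_vs.
Proof.
move=> tW; have {tW} := memv_img (ract_lfun tensK_rmod a) tW.
rewrite ract_lfunE; apply/subvP; rewrite limg_sum.
apply/subv_sumP=> i _; rewrite limg_sum; apply/subv_sumP=> j _.
rewrite limg_sum; apply/subv_sumP=> l _.
by rewrite limg_line -memvE ract_lfunE balance_act balance_mem.
Qed.

Definition balance_submod : submod tensK_rmod := Submod balance_vs_stable.

(* X (x)_S M, with tens its pure tensors; see tens_universal.                 *)
Definition schurF : rmodType A := quot_rmod balance_submod.

Definition tens (x : X) (m : M) : schurF :=
  quot_pi balance_submod (pureK x m).

Lemma tens_linearl m : linear (fun x => tens x m).
Proof. by move=> k x y; rewrite /tens pureK_linearl linearP. Qed.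

Lemma tens_linearr x : linear (tens x).
Proof. by move=> k m n; rewrite /tens pureK_linearr linearP. Qed.

Lemma tens_balanced x s m : tens (ract x s) m = tens x (end_app s m).
Proof.
apply/eqP; rewrite -subr_eq0 -linearB quot_pi_eq0; exact: balance_mem.
Qed.

Lemma tens_act x m a : ract (tens x m) a = tens x (ract m a).
Proof. by rewrite -[LHS]quot_pi_rhom pureK_act. Qed.

Lemma tens_universal (V : vectType K) (b : X -> M -> V) :
  (forall m, linear (fun x => b x m)) -> (forall x, linear (b x)) ->
  (forall x s m, b (ract x s) m = b x (end_app s m)) ->
  exists! h : 'Hom(schurF, V), forall x m, h (tens x m) = b x m.
Proof.
move=> b_linl b_linr b_bal.
pose co i : 'Hom(X, K^o) := linfun (coord (vbasis {:X}) i : X -> K^o).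
have tE (t : tensK) :
    t = \sum_(i < \dim {:X}) pureK (vbasis {:X})`_i (t (co i)).
  apply/lfunP=> phi; rewrite sum_lfunE.
  under eq_bigr do rewrite pureKE -linearZ; rewrite -linear_sum /=.
  congr (t _); apply/lfunP=> x; rewrite sum_lfunE.
  rewrite {1}(coord_vbasis (memvf x)) linear_sum; apply: eq_bigr => i _.
  by rewrite linearZ scale_lfunE lfunE /= [LHS]mulrC.
pose H0 (t : tensK) : V := \sum_(i < \dim {:X}) b (vbasis {:X})`_i (t (co i)).
have H0_lin : linear H0.
  move=> k t u; rewrite /H0 scaler_sumr -big_split; apply: eq_bigr => i _ /=.
  by rewrite add_lfunE scale_lfunE b_linr.
pose H : {linear tensK -> V} :=
  HB.pack H0 (GRing.isLinear.Build K tensK V _ H0 H0_lin).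
have HE x m : H (pureK x m) = b x m.
  pose bm : {linear X -> V} := HB.pack (fun x => b x m)
    (GRing.isLinear.Build K X V _ (fun x => b x m) (b_linl m)).
  rewrite -[RHS]/(bm x) {2}(coord_vbasis (memvf x)) linear_sum.
  apply: eq_bigr => i _; rewrite linearZ /= pureKE lfunE /=.
  pose bi : {linear M -> V} := HB.pack (b (vbasis {:X})`_i)
    (GRing.isLinear.Build K M V _ (b (vbasis {:X})`_i) (b_linr _)).
  exact: (linearZZ bi).
have HW t : t \in balance_vs -> H t = 0.
  move=> tW; apply/eqP; rewrite -(lfunE H) -memv_ker.
  apply/subvP: t tW; apply/subv_sumP=> i _; apply/subv_sumP=> j _.
  apply/subv_sumP=> l _; rewrite -memvE memv_ker lfunE.
  by rewrite [X in X == 0](linearB H) !HE b_bal subrr.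
pose h : 'Hom(schurF, V) :=
  (linfun H \o linfun (vsval : quot_space balance_submod -> tensK))%VF.
have hE x m : h (tens x m) = b x m.
  pose t := pureK x m; pose v : tensK := vsval (quot_pi balance_submod t).
  have /HW : t - v \in balance_vs.
    exact: (quot_piB_mem balance_submod).
  rewrite (linearB H) HE => /eqP; rewrite subr_eq0 => /eqP ->.
  by rewrite comp_lfunE !lfunE.
exists h; split=> // h' h'E.
apply/lfunP=> q; rewrite -[q](quot_piK (W := balance_submod)).
rewrite (tE (vsval q)) !linear_sum; apply: eq_bigr => i _.
by rewrite [LHS]hE [RHS]h'E.
Qed.

End SchurFunctor.

(* D^mu = F(L^mu) is nonzero, i.e. mu belongs to the index set K.             *)
Definition in_K (K : fieldType) (SP : schurPair K) (I : Type)
    (L : I -> rmodType (schur_alg SP)) (mu : I) : Prop :=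
  rmod_nonzero (schurF (L mu)).

Definition self_dual (K : fieldType) (SP : schurPair K)
    (star : antiInvolution (sp_alg SP)) : Prop :=
  rmod_iso (sp_mod SP) (dual_rmod star (sp_mod SP)).

(* Main.v *)
Require Import Defs.
From mathcomp Require Import all_boot all_order all_algebra all_field.

(** Write S = End_A(M). The simple module L^mu sits inside P^lambda, and
    P^lambda, being the projective cover of a simple and hence cyclic module,
    is a direct summand of the regular module S_S ([projective_cover_split]).
    So L^mu maps nontrivially to S_S by some S-linear map f. Since S acts
    faithfully on M, some f(x) moves some m in M; and because f is S-linear,
    x (x) m |-> f(x) m is a well-defined map L^mu (x)_S M -> M. It takes a
    nonzero value, hence D^mu = L^mu (x)_S M is nonzero
    ([schurF_nonzero_of_rhom]). *)

Set Implicit Arguments.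
Unset Strict Implicit.
Unset Printing Implicit Defensive.

Import GRing.Theory.
Local Open Scope ring_scope.

Lemma rhom_comp (K : fieldType) (A : falgType K) (X Y Z : rmodType A)
    (g : 'Hom(Y, Z)) (f : 'Hom(X, Y)) :
  is_rhom g -> is_rhom f -> is_rhom (g \o f)%VF.
Proof. by move=> gA fA x a; rewrite !comp_lfunE fA gA. Qed.

Lemma rhom_inv (K : fieldType) (A : falgType K) (X Y : rmodType A)
    (g : 'Hom(X, Y)) :
  is_rhom g -> bijective g -> is_rhom (g^-1)%VF /\ cancel (g^-1)%VF g.
Proof.
move=> gA g_bij; have [g' _ g'K] := g_bij.
have gVK : cancel (g^-1)%VF g.
  by move=> y; rewrite limg_lfunVK // -[y]g'K memv_img ?memvf.
by split=> // y a; apply: (bij_inj g_bij); rewrite gA !gVK.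
Qed.

Lemma rhom_limg_stable (K : fieldType) (A : falgType K) (X Y : rmodType A)
    (f : 'Hom(X, Y)) (y : Y) (a : A) :
  is_rhom f -> y \in limg f -> ract y a \in limg f.
Proof. by move=> fA /memv_imgP[x _ ->]; rewrite -fA memv_img ?memvf. Qed.

Definition rhom_limg (K : fieldType) (A : falgType K) (X Y : rmodType A)
    (f : 'Hom(X, Y)) (fA : is_rhom f) : submod Y :=
  Submod (fun y a => @rhom_limg_stable K A X Y f y a fA).

Definition orbit_map (K : fieldType) (A : falgType K) (X : rmodType A)
    (x : X) : 'Hom(regular_rmod A, X) := linfun (ract x).

Lemma orbit_mapE (K : fieldType) (A : falgType K) (X : rmodType A)
    (x : X) (a : A) : orbit_map x a = ract x a.
Proof. by rewrite lfunE. Qed.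

Lemma orbit_map_rhom (K : fieldType) (A : falgType K) (X : rmodType A)
    (x : X) : is_rhom (orbit_map x).
Proof. by move=> a b; rewrite !orbit_mapE ractM. Qed.

(** Any y in P with nonzero image in L generates P: the image of y A in L is a
    nonzero submodule, hence all of L, so y A + ker p = P, and ker p is
    superfluous. The surjection A -> P, a |-> y a, then splits because P is
    projective. *)
Lemma projective_cover_split (K : fieldType) (A : falgType K)
    (P L : rmodType A) (p : 'Hom(P, L)) :
  rmod_simple L -> projective_cover p ->
  exists2 j : 'Hom(P, regular_rmod A), is_rhom j & injective j.
Proof.
move=> [[l l_neq0] simL] [projP pA p_surj p_small].
have [y py] := p_surj l.
pose q := orbit_map y; have qA : is_rhom q := orbit_map_rhom y.
have pq_full : limg (p \o q)%VF = fullv.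
  have [pq0|//] := simL (rhom_limg (rhom_comp pA qA)).
  case: l_neq0; apply/eqP; rewrite -memv0 -pq0 -py -[y]ract1 -orbit_mapE.
  by rewrite -comp_lfunE memv_img ?memvf.
have q_full : limg q = fullv.
  apply: (p_small (rhom_limg qA)); apply/eqP; rewrite eqEsubv subvf /=.
  apply/subvP=> z _; have: p z \in limg (p \o q)%VF by rewrite pq_full memvf.
  case/memv_imgP=> a _; rewrite comp_lfunE => pz.
  rewrite -[z](subrK (q a)) addrC memv_add ?memv_img ?memvf //.
  by rewrite memv_ker linearB /= pz subrr.
have q_surj : lfun_surjective q.
  move=> z; have: z \in limg q by rewrite q_full memvf.
  by case/memv_imgP=> a _ ->; exists a.
have idA : is_rhom (\1%VF : 'End(P)) by move=> z a; rewrite !id_lfunE.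
have [j jA qj] := projP _ _ q \1%VF qA q_surj idA.
by exists j => //; apply: (can_inj (g := q)) => z; rewrite qj id_lfunE.
Qed.

(** The map x (x) m |-> f(x) m detects nonzero tensors because an element of
    S = End_A(M) that kills M is zero. *)
Lemma schurF_nonzero_of_rhom (K : fieldType) (SP : schurPair K)
    (X : rmodType (schur_alg SP))
    (f : 'Hom(X, regular_rmod (schur_alg SP))) (x : X) :
  is_rhom f -> f x <> 0 -> rmod_nonzero (schurF X).
Proof.
move=> fS fx_neq0.
pose b (z : X) (m : sp_mod SP) : sp_mod SP := end_app (f z) m.
have b_linl m : linear (fun z => b z m).
  by move=> k y z; rewrite /b linearP end_app_linearl.
have b_linr z : linear (b z) by exact: end_app_linearr.
have b_bal z s m : b (ract z s) m = b z (end_app s m).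
  by rewrite /b fS end_appM.
have [h [hE _]] := tens_universal b_linl b_linr b_bal.
have [m bxm_neq0] : exists m, b x m != 0.
  have /lfunPn[m]: vsval (f x : schur_sort SP) != 0.
    by apply/eqP=> fx0; apply: fx_neq0; apply: val_inj.
  by rewrite zero_lfunE; exists m.
exists (tens x m) => txm0; case/eqP: bxm_neq0.
by rewrite -hE txm0 linear0.
Qed.

Theorem corollary2p18 (K : fieldType) (SP : schurPair K)
    (splitA : split_alg (sp_alg SP)) (splitS : split_alg (schur_alg SP))
    (star : antiInvolution (sp_alg SP)) (sd : self_dual star)
    (I : Type) (L : I -> rmodType (schur_alg SP)) (hL : complete_simples L)
    (P : I -> rmodType (schur_alg SP)) (p : forall i, 'Hom(P i, L i))
    (hP : forall i, projective_cover (p i))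
    (lambda mu : I) :
  appears_in_socle (L mu) (P lambda) -> in_K L mu.
Proof.
case: hL => simL _ _ [W [_ [g [gS g_bij]]]].
have [j jS j_inj] := projective_cover_split (simL lambda) (hP lambda).
have [l l_neq0] := (simL mu).1.
have [hS hK] := rhom_inv gS g_bij.
pose incl : 'Hom(submod_rmod W, P lambda) := linfun vsval.
have inclS : is_rhom incl by move=> w s; rewrite !lfunE.
apply: (@schurF_nonzero_of_rhom _ _ _ (j \o incl \o g^-1)%VF l).
  by apply: rhom_comp hS; apply: rhom_comp.
rewrite !comp_lfunE lfunE -[RHS](linear0 j) => /j_inj gl0; apply: l_neq0.
have {gl0} gl0 : (g^-1)%VF l = 0 by apply: val_inj.
by rewrite -[l]hK gl0 linear0.
Qed.
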